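(* For each $q\in\{10,12,14,15\}$ there does not exist an $11\times 11$ complex matrix $H$ all of whose entries are complex $q$th roots of unity and with $HH^\ast=11I_{11}$; that is, $\mathrm{BH}(11,q)=\emptyset$ for $q\in\{10,12,14,15\}$.
   Context: $\mathrm{BH}(n,q)$ denotes the set of $n\times n$ complex matrices with all entries complex $q$th roots of unity satisfying $HH^\ast=nI_n$, where $H^\ast$ is the conjugate transpose. *)

(* Defs.v *)
From HB Require Import structures.
From mathcomp Require Import all_boot all_order all_algebra.
From mathcomp Require Import classical_sets reals.
From mathcomp Require Import complex.

Set Implicit Arguments.
Unset Strict Implicit.
Unset Printing Implicit Defensive.

Local Open Scope ring_scope.
Local Open Scope complex_scope.
Local Open Scope classical_set_scope.

Definition conjugate_transpose (C : numClosedFieldType) (m n : nat)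
    (H : 'M[C]_(m, n)) : 'M[C]_(n, m) :=
  map_mx Num.conj H^T.

Definition BH (C : numClosedFieldType) (n q : nat) : set 'M[C]_n :=
  [set H : 'M[C]_n | (forall i j, q.-unity_root (H i j)) /\
           H *m conjugate_transpose H = n%:R%:M].
Arguments BH : clear implicits.

(* Main.v *)
(** In all four cases the entries are written as powers of a primitive root of
    unity and the vanishing of the inner product of two rows is read off from
    the irreducibility of cyclotomic polynomials.

    For q = 12, |det H|^2 = 11^11.  Both primes of Q(sqrt 3) above 11 are inert
    in Q(zeta_12): embedding Q(sqrt 3) in the 11-adic numbers, a sum of two
    squares would have odd valuation.

    For q = 2p with p = 5 or 7, every entry is a sign times a p-th root of unity,
    and the signs of two distinct rows have inner product p or -p.  The parity
    of three rows fixes the product of the three inner products up to sign.  For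
    p = 5 one may then negate rows so that all inner products are -5, which is
    impossible for four rows of squared length 11.

    For p = 7 one may negate rows so that the sign matrix M satisfies
    M M^T = 4 I + 7 J.  Comparing with M^T M shows that M is, up to permuting and
    negating columns, J - 2 I.  First moments of the exponents then allow to make
    the exponent matrix symmetric with zero diagonal, and counting pairs shows
    that off the diagonal every row contains every exponent an even number of
    times.  An exhaustive search shows that no five rows of such a matrix exist.

    For q = 15, the cubic parts of two distinct rows have differences with
    multiplicities 7, 2, 2, and rows may be rescaled so that the matrix M of
    cubic parts satisfies M M^* = 6 I + 5 J.  Comparing with M^* M, every column
    sum has squared modulus 61, which is impossible for a sum of eleven cube
    roots of unity. *)

Require Import Defs.
From mathcomp Require Import all_boot all_order all_algebra.
From mathcomp Require Import cyclic all_field.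
From mathcomp Require Import ring lra zify.

Set Implicit Arguments.
Unset Strict Implicit.
Unset Printing Implicit Defensive.

Import Order.TTheory GRing.Theory Num.Theory.

Local Open Scope ring_scope.

(** * Integer relations between roots of unity *)

Lemma root_Cyclotomic_prim (C : numClosedFieldType) (n : nat) (z : C) :
  n.-primitive_root z -> root (map_poly intr 'Phi_n) z.
Proof.
move=> z_prim; have n_gt0 := prim_order_gt0 z_prim.
have: root (map_poly intr (\prod_(d <- divisors n) 'Phi_d)) z.
  rewrite prod_Cyclotomic // rmorphB rmorph1 /= map_polyXn.
  by rewrite rootE !hornerE prim_expr_order // subrr.
rewrite rmorph_prod rootE horner_prod prodf_seq_eq0 => /hasP[d].
rewrite -dvdn_divisors //= => d_n Phi_d0.
suff -> : n = d by [].
apply/eqP; rewrite eqn_dvd d_n andbT (prim_order_dvd z_prim).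
have d_gt0 := dvdn_gt0 n_gt0 d_n.
have: root (map_poly intr ('X^d - 1)) z.
  rewrite -prod_Cyclotomic // (big_rem d) -?dvdn_divisors //=.
  by rewrite rmorphM rootM rootE Phi_d0.
by rewrite rmorphB rmorph1 /= map_polyXn rootE !hornerE subr_eq0.
Qed.

(** In [algC] the minimal polynomial of a primitive root is ['Phi_n], so a common factor of [P] and
    ['Phi_n] over [rat] would force ['Phi_n] to divide [P]. Coprimality over [rat] carries over to
    [C]. *)
Lemma int_poly_prim_root_eq0 (C : numClosedFieldType) (n : nat) (z : C)
    (P : {poly int}) :
  n.-primitive_root z -> (size P <= totient n)%N ->
  root (map_poly intr P) z -> P = 0.
Proof.
move=> z_prim szP Pz0; apply/eqP; apply/idPn => P_neq0.
pose f : {poly rat} := map_poly intr 'Phi_n.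
pose g : {poly rat} := map_poly intr P.
have intr_ratr (K : numFieldType) (Q : {poly int}) :
    map_poly (@ratr K) (map_poly intr Q) = map_poly intr Q.
  by rewrite -map_poly_comp; apply: eq_map_poly => b; rewrite /= rmorph_int.
have g_neq0 : g != 0 by rewrite map_poly_eq0_id0 ?intr_eq0 ?lead_coef_eq0.
have cop : coprimep g f.
  rewrite /coprimep; apply/idPn => gcd_size.
  have [|x] := @closed_rootP algC (map_poly ratr (gcdp g f)) _.
    by rewrite size_map_poly.
  rewrite gcdp_map root_gcd => /andP[gx0 fx0].
  have [w w_prim] := C_prim_root_exists (prim_order_gt0 z_prim).
  have x_prim : n.-primitive_root x.
    by rewrite -(root_cyclotomic w_prim) -(Cintr_Cyclotomic w_prim) -intr_ratr.
  have [p [p_min _] p_dvd] := minCpolyP x.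
  have pf : p = f.
    apply: (map_inj_poly (fmorph_inj (@ratr algC)) (rmorph0 _)).
    by rewrite -p_min intr_ratr (minCpoly_cyclotomic x_prim) (Cintr_Cyclotomic x_prim).
  move: gx0; rewrite p_dvd pf => /(dvdp_leq g_neq0).
  rewrite /f /g !(size_map_inj_poly (@intr_inj rat)) // size_Cyclotomic.
  by rewrite ltnNge szP.
have cop' : coprimep (map_poly (@ratr C) g) (map_poly ratr f).
  by rewrite coprimep_map.
have := @coprimep_root _ _ _ z cop'; rewrite /g /f !intr_ratr => /(_ Pz0).
by apply/negP; rewrite negbK; apply: root_Cyclotomic_prim.
Qed.

Lemma exists_prim_root (C : numClosedFieldType) (n : nat) :
  (0 < n)%N -> exists z : C, n.-primitive_root z.
Proof.
move=> n_gt0; have [r r_prod] := closed_field_poly_normal ('X^n - 1 : {poly C}).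
rewrite (monicP (monicXnsubC _ n_gt0)) scale1r in r_prod.
have r_root : all n.-unity_root r.
  by apply/allP => z; rewrite -root_prod_XsubC -r_prod.
have r_uniq : uniq r.
  rewrite -separable_prod_XsubC -r_prod separable_Xn_sub_1 //.
  by rewrite pnatr_eq0 -lt0n.
have r_size : (n <= size r)%N.
  by rewrite -ltnS -(size_prod_XsubC r id) -r_prod size_XnsubC.
by have /hasP[z _] := has_prim_root n_gt0 r_root r_uniq r_size; exists z.
Qed.

Lemma conj_unity_root (C : numClosedFieldType) (n : nat) (z : C) :
  (0 < n)%N -> z ^+ n = 1 -> z^* = z^-1.
Proof.
move=> n_gt0 z_n; have /eqP z_norm : `|z| == 1.
  by rewrite -(@pexpr_eq1 _ _ n) // -normrX z_n normr1.
by rewrite invC_norm z_norm expr1n invr1 mul1r.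
Qed.

Lemma sum_prim_root (F : fieldType) (n : nat) (z : F) :
  (1 < n)%N -> n.-primitive_root z -> \sum_(i < n) z ^+ i = 0.
Proof.
move=> n_gt1 z_prim; apply/eqP.
have := subrX1 z n; rewrite (prim_expr_order z_prim) subrr => /esym/eqP.
rewrite mulf_eq0 subr_eq0 => /orP[/eqP z1|//].
have := eq_prim_root_expr z_prim 1 0; rewrite expr1 expr0 z1 eqxx.
by rewrite mod0n modn_small.
Qed.

Section PrimePower.
Variables (C : numClosedFieldType) (m : nat) (w : C).
Hypothesis w_prim : m.+2.-primitive_root w.

Lemma prim_root_expB (x y : 'I_m.+2) :
  w ^+ (x - y : 'I_m.+2)%R = w ^+ x * (w ^+ y)^*.
Proof.
have wy : (w ^+ y) ^+ m.+2 = 1 by rewrite exprAC (prim_expr_order w_prim) expr1n.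
rewrite (conj_unity_root _ wy) //.
apply: (canRL (mulfK _)).
  by apply/eqP => w0; move: wy; rewrite w0 expr0n => /eqP; rewrite eq_sym oner_eq0.
rewrite -exprD -(prim_expr_mod w_prim (_ + _)) -[in RHS](subrK y x).
by [].
Qed.

(** For prime order every integer relation among the powers of [w] is a multiple of
    [1 + w + ... + w^(m+1) = 0], so coefficients collected by exponent agree. *)
Lemma signed_vanishing_sum (I : finType) (s : I -> int) (a : I -> 'I_m.+2) :
  prime m.+2 -> \sum_k (s k)%:~R * w ^+ a k = 0 ->
  exists t : int, forall x, \sum_(k | a k == x) s k = t.
Proof.
move=> p_prime sum0; pose c x := \sum_(k | a k == x) s k.
exists (c ord_max) => x; rewrite -/(c x).
have csum : \sum_(x < m.+2) (c x - c ord_max)%:~R * w ^+ x = 0.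
  under eq_bigr => y _ do rewrite intrB mulrBl.
  rewrite sumrB -mulr_sumr sum_prim_root // mulr0 subr0 -[RHS]sum0.
  rewrite (partition_big a xpredT) //=; apply: eq_bigr => y _.
  by rewrite rmorph_sum mulr_suml; apply: eq_bigr => k /eqP ->.
(* The omitted top coefficient is 0 after the subtraction; [m.+1] is the totient. *)
pose Q : {poly int} := \poly_(i < m.+1) (c (inord i) - c ord_max).
have Q0 : Q = 0.
  apply: (int_poly_prim_root_eq0 w_prim); first by rewrite totient_prime // size_poly.
  have szQ : (size (map_poly intr Q : {poly C}) <= m.+1)%N.
    by rewrite (leq_trans (size_poly _ _)) // size_poly.
  rewrite rootE (horner_coef_wide _ szQ) -[X in _ == X]csum [X in _ == X]big_ord_recr /=.
  rewrite subrr rmorph0 mul0r addr0; apply/eqP/eq_bigr => i _.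
  rewrite coef_map coef_poly /= ltn_ord; congr ((c _ - _)%:~R * _).
  by apply: val_inj; rewrite /= inordK // ltnW // ltnS.
have [x_max|x_lt] := eqVneq x ord_max; first by rewrite x_max.
have x_ltm : (x < m.+1)%N.
  rewrite ltn_neqAle -ltnS ltn_ord andbT.
  by apply: contraNneq x_lt => x_m; apply/eqP/val_inj.
have := congr1 (fun P : {poly int} => P`_x) Q0.
by rewrite coef_poly x_ltm inord_val coef0 => /subr0_eq.
Qed.
End PrimePower.

Lemma int_poly_prim_root_dvd (C : numClosedFieldType) (n : nat) (z : C)
    (f P : {poly int}) :
  n.-primitive_root z -> f \is monic -> size f = (totient n).+1 ->
  root (map_poly intr f) z -> root (map_poly intr P) z ->
  exists Q, P = Q * f.
Proof.
move=> z_prim f_monic szf fz0 Pz0; exists (Pdiv.Ring.rdivp P f).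
rewrite {1}(Pdiv.RingMonic.rdivp_eq f_monic P) [X in _ + X](_ : _ = 0) ?addr0 //.
apply: (int_poly_prim_root_eq0 z_prim).
  by rewrite -ltnS -szf Pdiv.Ring.ltn_rmodpN0 // monic_neq0.
move: Pz0; rewrite {1}(Pdiv.RingMonic.rdivp_eq f_monic P) rmorphD rmorphM /=.
by rewrite !rootE hornerD hornerM (eqP fz0) mulr0 add0r.
Qed.

(** * Sign matrices and q = 10 *)

(** The inverse of [aI + bJ] is [a^-1 (I - cJ)] with [c = b/(a + nb)]. A right inverse of [M] is a
    left inverse, so [NM = aI + c NJM]; the entries of [NJM] are row sums of [N] times column sums
    of [M]. *)
Lemma mulmx_scalar_const (F : fieldType) (n : nat) (M N : 'M[F]_n) (a b : F) :
  M *m N = a%:M + const_mx b -> a != 0 -> a + n%:R * b != 0 ->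
  forall k l, \sum_i N k i * M i l =
    a *+ (k == l) + b / (a + n%:R * b) * (\sum_i N k i) * (\sum_i M i l).
Proof.
move=> MN a_neq0 ab_neq0 k l; pose c := b / (a + n%:R * b).
have const_mul (x y : F) :
    (const_mx x : 'M[F]_n) *m (const_mx y : 'M[F]_n) = const_mx (n%:R * x * y).
  apply/matrixP => i j; rewrite !mxE (eq_bigr (fun=> x * y)) => [|h _];
    last by rewrite !mxE.
  by rewrite sumr_const card_ord -mulrA mulr_natl.
have MN_inv : M *m (N *m (a^-1 *: (1%:M - const_mx c))) = 1%:M.
  rewrite mulmxA MN -scalemxAr mulmxBr mulmx1 mulmxDl const_mul mul_scalar_mx.
  have -> : a *: const_mx c = const_mx (a * c) :> 'M[F]_n.
    by apply/matrixP => i j; rewrite !mxE.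
  rewrite -scalemx1; apply/matrixP => i j; rewrite !mxE.
  by rewrite /c; field; rewrite ab_neq0.
have /matrixP/(_ k l) := mulmx1C MN_inv.
rewrite -scalemxAr -scalemxAl mulmxBr mulmx1 mulmxBl !mxE => /(canRL (mulVKf a_neq0)).
move=> /eqP; rewrite subr_eq mulr_natr => /eqP ->; congr (_ + _).
rewrite -mulrA mulr_sumr mulr_sumr; apply: eq_bigr => i _.
rewrite !mxE -/c mulrA; congr (_ * _); rewrite mulr_sumr.
by apply: eq_bigr => h _; rewrite mxE mulrC.
Qed.

Definition sign_dot (n : nat) (s : 'I_n -> 'I_n -> bool) (i j : 'I_n) : int :=
  \sum_k (-1) ^+ s i k * (-1) ^+ s j k.

Lemma sign_dotC (n : nat) (s : 'I_n -> 'I_n -> bool) (i j : 'I_n) :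
  sign_dot s i j = sign_dot s j i.
Proof. by apply: eq_bigr => k _; rewrite mulrC. Qed.

Lemma sign_dot_card (n : nat) (s : 'I_n -> 'I_n -> bool) (i j : 'I_n) :
  exists2 d : nat, (d <= n)%N & sign_dot s i j = n%:Z - 2 * d%:Z.
Proof.
pose A := [pred k | s i k (+) s j k]; exists #|A|.
  by rewrite -[X in (_ <= X)%N]card_ord max_card.
have -> : n%:Z = \sum_(k < n) 1 by rewrite sumr_const card_ord natz.
have -> : #|A|%:Z = \sum_(k < n) (s i k (+) s j k)%:R.
  rewrite -sum1_card -[LHS]natz natr_sum big_mkcond /=; apply: eq_bigr => k _.
  by rewrite inE; case: (_ (+) _).
rewrite mulr_sumr -sumrB; apply: eq_bigr => k _.
by case: (s i k); case: (s j k).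
Qed.

(* [1 + xy + yz + xz] is [4] when the three signs agree and [0] otherwise. *)
Lemma sign_dot_triple (n : nat) (s : 'I_n -> 'I_n -> bool) (i j l : 'I_n) :
  exists u : int,
    n%:Z + sign_dot s i j + sign_dot s j l + sign_dot s i l = 4 * u.
Proof.
exists (\sum_k ((s i k == s j k) && (s j k == s l k))%:R).
have -> : n%:Z = \sum_(k < n) 1 by rewrite sumr_const card_ord natz.
rewrite mulr_sumr -!big_split /=; apply: eq_bigr => k _.
by case: (s i k); case: (s j k); case: (s l k).
Qed.

(** This is the squared length of a signed sum of four rows. *)
Lemma sign_dot_sum_sqr (n : nat) (s : 'I_n -> 'I_n -> bool)
    (i j l h : 'I_n) (b c d : bool) :
  0 <= 4 * n%:Z + 2 * ((-1) ^+ b * sign_dot s i j + (-1) ^+ c * sign_dot s i l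
     + (-1) ^+ d * sign_dot s i h + (-1) ^+ b * (-1) ^+ c * sign_dot s j l
     + (-1) ^+ b * (-1) ^+ d * sign_dot s j h
     + (-1) ^+ c * (-1) ^+ d * sign_dot s l h).
Proof.
have -> : n%:Z = \sum_(k < n) 1 by rewrite sumr_const card_ord natz.
rewrite !mulr_sumr -!big_split /= mulr_sumr -big_split /=; apply: sumr_ge0 => k _.
by case: (s i k); case: (s j k); case: (s l k); case: (s h k);
   case: b; case: c; case: d.
Qed.

Lemma sign_dot_not_pm5 (s : 'I_11 -> 'I_11 -> bool) :
  ~ (forall i j, i != j -> exists t, sign_dot s i j = 5 * t).
Proof.
move=> dot5.
have pm i j : i != j -> sign_dot s i j = 5 \/ sign_dot s i j = -5.
  move=> /dot5[t]; have [d d_le ->] := sign_dot_card s i j; lia.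
pose i0 := @Ordinal 11 0 isT; pose i1 := @Ordinal 11 1 isT.
pose i2 := @Ordinal 11 2 isT; pose i3 := @Ordinal 11 3 isT.
have [u1] := sign_dot_triple s i0 i1 i2; have [u2] := sign_dot_triple s i0 i1 i3.
have [u3] := sign_dot_triple s i0 i2 i3; have [u4] := sign_dot_triple s i1 i2 i3.
have sq := sign_dot_sum_sqr s i0 i1 i2 i3.
(* By parity the three inner products of any triple of rows have negative product. So some choice of
   signs turns all six terms into -5, with squared length [44 - 60]. *)
move: (sq true true true) (sq true true false) (sq true false true)
  (sq true false false) (sq false true true) (sq false true false)
  (sq false false true) (sq false false false).
rewrite /= !expr1 !expr0.
by have [->|->] := pm i0 i1 isT; have [->|->] := pm i0 i2 isT;
   have [->|->] := pm i0 i3 isT; have [->|->] := pm i1 i2 isT;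
   have [->|->] := pm i1 i3 isT; have [->|->] := pm i2 i3 isT; lia.
Qed.

(** * Signs and exponents for q twice an odd prime *)

Section DoublePrime.
Variables (C : numClosedFieldType) (n m : nat) (H : 'M[C]_n).
Hypotheses (p_prime : prime m.+2) (p_odd : odd m).
Hypothesis H_root : forall i j, (2 * m.+2).-unity_root (H i j).
Hypothesis H_orth : forall i j, i != j -> \sum_k H i k * (H j k)^* = 0.

(** The [p]-th power of an entry is 1 or -1; as [p] is odd, splitting off this sign leaves a [p]-th
    root of unity. *)
Lemma double_prime_exponents :
  exists (s : 'I_n -> 'I_n -> bool) (a : 'I_n -> 'I_n -> 'I_m.+2),
    forall i j, i != j ->
      exists t : int, forall x,
        \sum_(k | a i k - a j k == x) (-1) ^+ s i k * (-1) ^+ s j k = t.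
Proof.
have [w w_prim] := exists_prim_root C (ltn0Sn m.+1).
have rep (ij : 'I_n * 'I_n) :
    exists sa : bool * 'I_m.+2, H ij.1 ij.2 = (-1) ^+ sa.1 * w ^+ sa.2.
  move/unity_rootP: (H_root ij.1 ij.2); set h := H _ _; rewrite mulnC exprM.
  move/eqP; rewrite sqrf_eq1 => /orP[] /eqP hp.
    by have [a ->] := prim_rootP w_prim hp; exists (false, a); rewrite mul1r.
  have hp' : (- h) ^+ m.+2 = 1.
    by rewrite exprNn hp -signr_odd /= negbK p_odd expr1 mulrNN mulr1.
  have [a a_h] := prim_rootP w_prim hp'; exists (true, a).
  by rewrite -a_h expr1 mulN1r opprK.
have [sa saP] := fin_all_exists rep.
exists (fun i j => (sa (i, j)).1), (fun i j => (sa (i, j)).2) => i j /H_orth orth.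
apply: (signed_vanishing_sum w_prim p_prime); rewrite -[RHS]orth.
apply: eq_bigr => k _; rewrite (saP (i, k)) (saP (j, k)) (prim_root_expB w_prim).
rewrite rmorphM /= rmorph_sign rmorphM /= !rmorph_sign; ring.
Qed.

End DoublePrime.

Lemma sign_dot_count (n m : nat) (s : 'I_n -> 'I_n -> bool)
    (a : 'I_n -> 'I_n -> 'I_m.+2) (i j : 'I_n) (t : int) :
  (forall x, \sum_(k | a i k - a j k == x) (-1) ^+ s i k * (-1) ^+ s j k = t) ->
  sign_dot s i j = m.+2%:Z * t.
Proof.
move=> count_t; rewrite /sign_dot (partition_big (fun k => a i k - a j k) xpredT) //=.
under eq_bigr do rewrite count_t.
by rewrite sumr_const card_ord -mulr_natl natz.
Qed.

(** * The cubic parts for q = 15 *)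

Definition phi15 : {poly int} :=
  'X^8 - 'X^7 + 'X^5 - 'X^4 + 'X^3 - 'X + 1.

Section Fifteen.
Variables (C : numClosedFieldType) (z : C).
Hypothesis z_prim : 15.-primitive_root z.

Let w := z ^+ 5.

Lemma cube_prim : 3.-primitive_root w.
Proof. by rewrite /w; apply: (dvdn_prim_root z_prim). Qed.

Lemma horner_phi15 (x : C) :
  (map_poly intr phi15).[x] = x ^+ 8 - x ^+ 7 + x ^+ 5 - x ^+ 4 + x ^+ 3 - x + 1.
Proof.
rewrite /phi15 !(rmorphB, rmorphD, rmorph1) /= !map_polyXn map_polyX.
by rewrite !hornerE.
Qed.

Lemma root_phi15 : root (map_poly intr phi15) z.
Proof.
have z15 := prim_expr_order z_prim.
have neq k : (0 < k < 15)%N -> z ^+ k - 1 != 0.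
  move=> /andP[k_gt0 k_lt]; rewrite subr_eq0 -(prim_order_dvd z_prim).
  by rewrite gtnNdvd.
(* [Phi_15 (X^5 - 1)(X^3 - 1) = (X^15 - 1)(X - 1)]. *)
have : (map_poly intr phi15).[z] * (z ^+ 5 - 1) * (z ^+ 3 - 1) = 0.
  rewrite horner_phi15; transitivity ((z ^+ 15 - 1) * (z - 1)); first by ring.
  by rewrite z15 subrr mul0r.
by move/eqP; rewrite !mulf_eq0 !(negbTE (neq _ _)) // !orbF.
Qed.

Lemma horner_phi15_cube : (map_poly intr phi15).[w] = - 5 * w.
Proof.
have w3 := prim_expr_order cube_prim.
have := @sum_prim_root _ 3 w isT cube_prim; rewrite !big_ord_recr big_ord0 /= expr0 expr1.
move=> w_sum; rewrite horner_phi15.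
have -> : w ^+ 8 = w ^+ 2 by rewrite -[8%N]/(3 + 3 + 2)%N !exprD w3 !mul1r.
have -> : w ^+ 7 = w by rewrite -[7%N]/(3 + 3 + 1)%N !exprD w3 !mul1r.
have -> : w ^+ 5 = w ^+ 2 by rewrite -[5%N]/(3 + 2)%N !exprD w3 !mul1r.
have -> : w ^+ 4 = w by rewrite -[4%N]/(3 + 1)%N !exprD w3 !mul1r.
rewrite w3; have -> : w ^+ 2 = - 1 - w.
  by apply/eqP; rewrite -subr_eq0 -w_sum; apply/eqP; ring.
by ring.
Qed.

Variable H : 'M[C]_11.
Hypothesis H_root : forall i j, 15.-unity_root (H i j).
Hypothesis H_orth : forall i j, i != j -> \sum_k H i k * (H j k)^* = 0.

Lemma phi15_monic_size : phi15 \is monic /\ size phi15 = 9%N.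
Proof.
have -> : phi15 = Poly [:: 1; -1; 0; 1; -1; 1; 0; -1; 1].
  by rewrite /phi15 /= !cons_poly_def; ring.
have P_eq : Poly [:: 1; -1; 0; 1; -1; 1; 0; -1; 1 : int] =
    [:: 1; -1; 0; 1; -1; 1; 0; -1; 1] :> seq int.
  by rewrite (@PolyK _ 0).
by rewrite monicE lead_coefE P_eq.
Qed.

(** [a] records exponents modulo 3. The orthogonality polynomial is [P = Q * phi15], so
    [P(w) = -5 w Q(w)]; as a relation among cube roots of unity this makes the three counts
    congruent modulo 5. *)
Lemma fifteen_counts : exists a : 'I_11 -> 'I_11 -> 'I_3,
  forall i j, i != j -> exists t : int, forall x, exists c : int,
    #|[pred k | a i k - a j k == x]|%:Z = t + 5 * c.
Proof.
have rep (ij : 'I_11 * 'I_11) : exists e : 'I_15, H ij.1 ij.2 = z ^+ e.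
  by have [e ->] := prim_rootP z_prim (unity_rootP (H_root ij.1 ij.2)); exists e.
have [e eP] := fin_all_exists rep.
exists (fun i j => inord (e (i, j) %% 3)) => i j /H_orth orth.
pose d k : 'I_15 := e (i, k) - e (j, k).
pose P : {poly int} := \sum_k 'X^(d k).
have PE (x : C) : (map_poly intr P).[x] = \sum_k x ^+ d k.
  rewrite rmorph_sum /= horner_sum; apply: eq_bigr => k _.
  by rewrite map_polyXn hornerXn.
have Pz : root (map_poly intr P) z.
  rewrite rootE PE -[X in _ == X]orth; apply/eqP/eq_bigr => k _.
  by rewrite (eP (i, k)) (eP (j, k)) (prim_root_expB z_prim).
have [f_monic f_size] := phi15_monic_size.
have [//|Q PQ] := int_poly_prim_root_dvd z_prim f_monic _ root_phi15 Pz.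
(* The terms [5 Q_l w^(l+1)] of [5 w Q(w)] join the eleven powers of [w] in one vanishing sum. *)
pose I := ('I_11 + 'I_(size Q))%type.
pose s (k : I) : int := match k with inl _ => 1 | inr l => 5 * Q`_l end.
pose b (k : I) : 'I_3 :=
  match k with inl k => inord (e (i, k) %% 3) - inord (e (j, k) %% 3)
             | inr l => inord (l.+1 %% 3) end.
have w3_mod (u : nat) : w ^+ (inord (u %% 3) : 'I_3) = w ^+ u.
  by rewrite inordK ?ltn_pmod // (prim_expr_mod cube_prim).
have sum0 : \sum_(k : I) (s k)%:~R * w ^+ b k = 0.
  rewrite big_sumType /=.
  have -> : \sum_(k < 11) 1%:~R *
      w ^+ (inord (e (i, k) %% 3) - inord (e (j, k) %% 3) : 'I_3)%R =
      (map_poly intr P).[w].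
    rewrite PE; apply: eq_bigr => k _; rewrite mul1r (prim_root_expB cube_prim) !w3_mod.
    rewrite /w -!exprM mulnC exprM (mulnC 5 (e (j, k))) exprM.
    by rewrite rmorphXn /= -exprMn -(prim_root_expB z_prim) -!exprM mulnC.
  rewrite PQ rmorphM hornerM horner_phi15_cube horner_coef size_map_inj_poly //;
    last exact: intr_inj.
  rewrite mulr_suml -big_split big1 //= => l _.
  rewrite w3_mod coef_map exprS intrM /=; ring.
have [t tP] := signed_vanishing_sum cube_prim (isT : prime 3) sum0.
exists t => x; exists (- \sum_(l < size Q | (inord (l.+1 %% 3) : 'I_3) == x) Q`_l).
rewrite -(tP x) big_sumType /= -mulr_sumr mulrN addrK -sum1_card.
by rewrite -[LHS]natz natr_sum.
Qed.

End Fifteen.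

Lemma sum_card_eq (I J : finType) (a : I -> J) :
  (\sum_x #|[pred k | a k == x]|)%N = #|I|.
Proof.
by rewrite -[RHS]sum1_card (partition_big a xpredT) //=; apply: eq_bigr => x _;
   rewrite -sum1_card.
Qed.

Lemma sum_card_val (I : finType) (R : nzRingType) (J : finType) (g : J -> R)
    (a : I -> J) :
  \sum_k g (a k) = \sum_x g x *+ #|[pred k | a k == x]|.
Proof.
rewrite (partition_big a xpredT) //=; apply: eq_bigr => x _.
by rewrite (eq_bigr (fun=> g x)) ?sumr_const // => k /eqP ->.
Qed.

(** Three counts congruent modulo 5 with sum 11 are 7, 2, 2. The first moment is five times the
    residue counted 7 times, hence minus that residue modulo 3. *)
Lemma ternary_counts (a : 'I_11 -> 'I_11 -> 'I_3) (i j : 'I_11) (t : int) :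
  (forall x, exists c : int, #|[pred k | a i k - a j k == x]|%:Z = t + 5 * c) ->
  forall x, #|[pred k | a i k - a j k == x]| =
    (2 + 5 * (x == (\sum_k a j k - \sum_k a i k)%R))%N.
Proof.
move=> cong; pose n x := #|[pred k | a i k - a j k == x]|.
have n_sum : (\sum_x n x = 11)%N by rewrite sum_card_eq card_ord.
have moment : \sum_k a i k - \sum_k a j k = \sum_(x : 'I_3) x *+ n x.
  by rewrite -sumrB (sum_card_val id).
rewrite -[\sum_k a j k - _]opprB moment => x; rewrite -/(n x).
pose x0 : 'I_3 := ord0; pose x1 : 'I_3 := 1; pose x2 : 'I_3 := 2.
have [c0 n0] := cong x0; have [c1 n1] := cong x1; have [c2 n2] := cong x2.
rewrite -/(n x0) in n0; rewrite -/(n x1) in n1; rewrite -/(n x2) in n2.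
have ord3E (g : 'I_3 -> nat) : (\sum_x g x = g x0 + g x1 + g x2)%N.
  rewrite !big_ord_recr big_ord0 /= add0n; congr (g _ + g _ + g _)%N; exact: val_inj.
have ord3R (g : 'I_3 -> 'I_3) : \sum_x g x = g x0 + g x1 + g x2.
  rewrite !big_ord_recr big_ord0 /= add0r; congr (g _ + g _ + g _); exact: val_inj.
move: n_sum; rewrite ord3E ord3R => n_sum.
have x_cases : x = x0 \/ x = x1 \/ x = x2.
  by case: x => -[|[|[|//]]] lt; [left|right; left|right; right]; apply: val_inj.
have [[n0E [n1E n2E]]|[[n0E [n1E n2E]]|[n0E [n1E n2E]]]] :
    (n x0 = 7 /\ n x1 = 2 /\ n x2 = 2 \/ n x0 = 2 /\ n x1 = 7 /\ n x2 = 2 \/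
     n x0 = 2 /\ n x1 = 2 /\ n x2 = 7)%N by lia.
all: by rewrite n0E n1E n2E; case: x_cases => [->|[->|->]]; rewrite ?n0E ?n1E ?n2E.
Qed.

Lemma ternary_matrix_contradiction (C : numClosedFieldType) (w : C)
    (b : 'I_11 -> 'I_11 -> 'I_3) :
  3.-primitive_root w ->
  ~ (forall i j, i != j -> forall x,
       #|[pred k | b i k - b j k == x]| = (2 + 5 * (x == 0%R))%N).
Proof.
move=> w_prim counts; pose M : 'M[C]_11 := \matrix_(i, k) w ^+ b i k.
pose N : 'M[C]_11 := \matrix_(k, i) (w ^+ b i k)^*.
have w3 := prim_expr_order w_prim.
have := @sum_prim_root _ 3 w isT w_prim; rewrite !big_ord_recr big_ord0 /=.
rewrite add0r expr0 expr1 => w_sum.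
have MN : M *m N = 6%:M + const_mx 5.
  apply/matrixP => i j; rewrite !mxE.
  rewrite (eq_bigr (fun k => w ^+ (b i k - b j k : 'I_3)%R)); last first.
    by move=> k _; rewrite !mxE prim_root_expB.
  have [<-|ij] := eqVneq i j.
    rewrite (eq_bigr (fun=> 1)) => [|k _]; last by rewrite subrr.
    by rewrite sumr_const card_ord mulr1n; ring.
  rewrite (sum_card_val (fun x : 'I_3 => w ^+ x)).
  under eq_bigr => x _ do rewrite counts //.
  rewrite !big_ord_recr big_ord0 /= mulr0n !add0r expr0 expr1.
  by rewrite -[LHS]subr0 -[X in _ - X](mulr0 2) -[X in _ - _ * X]w_sum; ring.
have neq0 (k : nat) : k.+1%:R != 0 :> C by rewrite pnatr_eq0.
have w_neq0 : w != 0.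
  by apply/eqP => w0; move/eqP: w3; rewrite w0 expr0n eq_sym oner_eq0.
have w_conj : w^* = w ^+ 2.
  by rewrite (conj_unity_root _ w3) // -[LHS]mulr1 -w3 exprS mulKf.
pose n x := #|[pred i | b i ord0 == x]|.
pose x0 : 'I_3 := ord0; pose x1 : 'I_3 := 1; pose x2 : 'I_3 := 2.
have ord3 (T : Type) (idx : T) (op : Monoid.law idx) (g : 'I_3 -> T) :
    \big[op/idx]_x g x = op (op (g x0) (g x1)) (g x2).
  rewrite !big_ord_recr big_ord0 /= Monoid.mul1m.
  by congr (op (op (g _) (g _)) (g _)); apply: val_inj.
have n_sum : (n x0 + n x1 + n x2 = 11)%N.
  by rewrite -[LHS](ord3 _ 0%N addn n) sum_card_eq card_ord.
have M_sum : \sum_i M i ord0 = (n x0)%:R + (n x1)%:R * w + (n x2)%:R * w ^+ 2.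
  under eq_bigr => i _ do rewrite mxE.
  rewrite (sum_card_val (fun x : 'I_3 => w ^+ x)) ord3 /= expr0 expr1.
  by rewrite !mulr_natl.
have N_sum : \sum_i N ord0 i = (n x0)%:R + (n x1)%:R * w ^+ 2 + (n x2)%:R * w.
  transitivity ((\sum_i M i ord0)^*).
    by rewrite rmorph_sum; apply: eq_bigr => i _; rewrite !mxE.
  have w2_conj : (w ^+ 2)^* = w.
    by rewrite rmorphXn /= w_conj -exprM (exprD w 3 1) w3 mul1r.
  rewrite M_sum !rmorphD (rmorphM _ (n x1)%:R) (rmorphM _ (n x2)%:R) /= !rmorph_nat.
  by rewrite w_conj w2_conj.
have ab_neq0 : 6 + 11%:R * 5 != 0 :> C by rewrite -natrM -natrD neq0.
(* The diagonal of [N M] gives [11 = 6 + (5/61) |S|^2] for a column sum [S], where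
   [61 = 6 + 11 * 5]. *)
have := mulmx_scalar_const MN (neq0 5) ab_neq0 ord0 ord0.
rewrite (eq_bigr (fun=> 1)) => [|i _]; last first.
  by rewrite !mxE mulrC -prim_root_expB // subrr.
rewrite sumr_const card_ord eqxx M_sum N_sum mulr1n => norm.
have {}norm : ((n x0)%:R + (n x1)%:R * w ^+ 2 + (n x2)%:R * w) *
    ((n x0)%:R + (n x1)%:R * w + (n x2)%:R * w ^+ 2) = 61 :> C.
  move: norm; have -> : 6 + 11%:R * 5 = 61 :> C by ring.
  move: ((n x0)%:R + (n x1)%:R * w ^+ 2 + (n x2)%:R * w) => X.
  move: ((n x0)%:R + (n x1)%:R * w + (n x2)%:R * w ^+ 2) => Y norm.
  have -> : X * Y = 5 / 61 * X * Y * 61 / 5 by field.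
  have -> : 5 / 61 * X * Y = 5 by apply: (addrI 6); rewrite -norm; ring.
  by field.
have {}norm : (n x0 ^ 2 + n x1 ^ 2 + n x2 ^ 2 =
    61 + (n x0 * n x1 + n x0 * n x2 + n x1 * n x2))%N.
  apply/eqP; rewrite -(eqr_nat C) !natrD !natrX !natrM -norm -subr_eq0.
  move: (n x0)%:R (n x1)%:R (n x2)%:R => u v t; apply/eqP.
  transitivity ((1 - w ^+ 3) * (v ^+ 2 + t ^+ 2 + v * t * w)
                - (u * v + u * t + v * t) * (1 + w + w ^+ 2)); first by ring.
  by rewrite w3 w_sum subrr mul0r mulr0 subrr.
move: (n x0) (n x1) (n x2) n_sum norm => n0 n1 n2 n_sum norm.
have no_sol : all (fun a => all (fun b => let c := (11 - a - b)%N in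
    (a + b <= 11)%N ==>
    (a ^ 2 + b ^ 2 + c ^ 2 != 61 + (a * b + a * c + b * c))%N)
    (iota 0 12)) (iota 0 12) by vm_compute.
have /(allP no_sol)/allP/(_ n1) : n0 \in iota 0 12 by rewrite mem_iota; lia.
have n2E : n2 = (11 - n0 - n1)%N by lia.
have -> : n1 \in iota 0 12 by rewrite mem_iota; lia.
move=> /(_ isT)/implyP; rewrite -n2E norm eqxx => /(_ _)/implyP.
by case; lia.
Qed.

(** * The determinant for q = 12 *)

(** -1 is not a square modulo 11; all pairs of residues are checked. *)
Lemma dvd11_sum_sqr (x y m : int) : x ^+ 2 + y ^+ 2 = 11 * m ->
  exists x' y', x = 11 * x' /\ y = 11 * y'.
Proof.
have euclid (u : int) : exists q r : int, u = 11 * q + r /\ 0 <= r < 11.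
  exists (u %/ 11)%Z, (u %% 11)%Z; split; first by rewrite mulrC -divz_eq.
  by rewrite modz_ge0 // ltz_pmod.
have [q [r [-> r_lt]]] := euclid x; have [q' [r' [-> r'_lt]]] := euclid y => sqr.
have {}sqr : exists m', r * r + r' * r' = 11 * m'.
  by exists (m - 11 * q ^+ 2 - 2 * q * r - 11 * q' ^+ 2 - 2 * q' * r'); lia.
suff [-> ->] : r = 0 /\ r' = 0 by exists q, q'; rewrite !addr0.
case: sqr => m'.
have small (u : int) : 0 <= u < 11 -> u \in [seq k%:Z | k <- iota 0 11].
  by move=> u_lt; apply/mapP; exists `|u|%N; rewrite ?mem_iota; lia.
move: (small _ r_lt) (small _ r'_lt); rewrite /= !inE.
by do 10?[case/orP]; move/eqP=> ->; do 10?[case/orP]; move/eqP=> ->; lia.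
Qed.

(** Descent: dividing [x] and [y] by 11 lowers the odd exponent by 2, and at exponent 1 the factor
    [4 + 11 * v] is prime to 11. *)
Lemma sum_sqr_odd_val11 (k : nat) (x y v : int) :
  x ^+ 2 + y ^+ 2 <> 11 ^+ k.*2.+1 * (4 + 11 * v).
Proof.
elim: k x y => [|k IHk] x y sqr.
  have [x' [y' [xE yE]]] := dvd11_sum_sqr sqr.
  by move: sqr; rewrite xE yE expr1; lia.
have [|x' [y' [xE yE]]] := @dvd11_sum_sqr x y (11 ^+ k.*2.+2 * (4 + 11 * v)).
  by rewrite sqr doubleS exprS mulrA.
apply: (IHk x' y'); apply: (@mulfI _ 121) => //.
transitivity (x ^+ 2 + y ^+ 2); first by rewrite xE yE; ring.
by rewrite sqr doubleS 2!exprS; move: (11 ^+ _) => N; ring.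
Qed.

(** Hensel lifting from [5^2 = 3 + 11 * 2]. Newton's correction uses that [2 s] is its own inverse
    modulo 11, as [4 s^2] is congruent to 12. *)
Lemma sqrt3_mod11 (n : nat) : exists s t : int, s ^+ 2 = 3 + 11 ^+ n.+1 * t.
Proof.
elim: n => [|n [s [t st]]]; first by exists 5, 2.
exists (s * (1 - 2 * t * 11 ^+ n.+1)).
exists (- t + 11 ^+ n * (8 * t ^+ 2 + 4 * t ^+ 3 * 11 ^+ n.+1)).
by rewrite exprMn st !exprS; ring.
Qed.

(* For [z] a primitive 12th root of unity, [|a + b z + c z^2 + d z^3|^2] is the
   first form plus [sqrt 3] times the second one. *)
Lemma no_norm_11_odd (a b c d : int) :
  a ^+ 2 + b ^+ 2 + c ^+ 2 + d ^+ 2 + a * c + b * d = 11 ^+ 11 ->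
  a * b + b * c + c * d <> 0.
Proof.
move=> norm1 norm0; have [s [t st]] := sqrt3_mod11 11.
(* Twice the real and imaginary parts of [a + b z + c z^2 + d z^3] for [z = (sqrt 3 + i)/2], with
   [s] in place of [sqrt 3]. *)
apply: (@sum_sqr_odd_val11 5 (2 * a + c + b * s) (b + 2 * d + c * s)
  (t * (b ^+ 2 + c ^+ 2))).
transitivity (4 * (a ^+ 2 + b ^+ 2 + c ^+ 2 + d ^+ 2 + a * c + b * d)
  + 4 * s * (a * b + b * c + c * d) + (s ^+ 2 - 3) * (b ^+ 2 + c ^+ 2)); first by ring.
rewrite norm1 norm0 st [11 ^+ 12]exprS; move: (11 ^+ 11) => N; ring.
Qed.

Section Twelve.
Variables (C : numClosedFieldType) (H : 'M[C]_11).
Hypothesis H_root : forall i j, 12.-unity_root (H i j).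
Hypothesis H_unitary : H *m map_mx Num.conj H^T = 11%:R%:M.

Lemma no_BH_11_12 : False.
Proof.
have [z z_prim] := exists_prim_root C (isT : 0 < 12)%N.
have z4 : z ^+ 4 = z ^+ 2 - 1.
  have z12 := prim_expr_order z_prim.
  have neq k : (0 < k < 12)%N -> z ^+ k - 1 != 0.
    by move=> /andP[k_gt0 k_lt]; rewrite subr_eq0 -(prim_order_dvd z_prim) gtnNdvd.
  have : (z ^+ 4 - (z ^+ 2 - 1)) * (z ^+ 6 - 1) * (z ^+ 4 - 1) = 0.
    transitivity ((z ^+ 12 - 1) * (z ^+ 2 - 1)); first by ring.
    by rewrite z12 subrr mul0r.
  move/eqP; rewrite !mulf_eq0 !(negbTE (neq _ _)) // !orbF subr_eq0.
  by move/eqP.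
have rep (ij : 'I_11 * 'I_11) : exists e : 'I_12, H ij.1 ij.2 = z ^+ e.
  by have [e ->] := prim_rootP z_prim (unity_rootP (H_root ij.1 ij.2)); exists e.
have [e eP] := fin_all_exists rep.
pose ev : {rmorphism {poly int} -> C} := horner_eval z \o map_poly intr.
pose D : {poly int} := \det (\matrix_(i, j) 'X^(e (i, j))).
have detH : \det H = ev D.
  rewrite -det_map_mx; congr (\det _); apply/matrixP => i j.
  by rewrite !mxE /= /horner_eval map_polyXn hornerXn (eP (i, j)).
pose f : {poly int} := Poly [:: 1; 0; -1; 0; 1].
have fE : f = [:: 1; 0; -1; 0; 1] :> seq int by rewrite /f (@PolyK _ 0).
have f_monic : f \is monic by rewrite monicE lead_coefE fE.
have evE (P : {poly int}) n : (size P <= n)%N -> ev P = \sum_(i < n) (P`_i)%:~R * z ^+ i.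
  move=> szP; rewrite /= /horner_eval (@horner_coef_wide _ n).
    by apply: eq_bigr => i _; rewrite coef_map.
  exact: leq_trans (size_poly _ _) szP.
have ev_f : ev f = 0.
  rewrite (@evE _ 5) ?fE // !big_ord_recr big_ord0 /=.
  by rewrite z4; ring.
(* Reduction modulo [Phi_12] expresses [\det H] by four integer coordinates. *)
pose r := Pdiv.Ring.rmodp D f.
have r_size : (size r <= 4)%N.
  by rewrite -ltnS (leq_trans (Pdiv.Ring.ltn_rmodpN0 _ (monic_neq0 f_monic))) ?fE.
have ev_r : ev D = ev r.
  by rewrite {1}(Pdiv.RingMonic.rdivp_eq f_monic D) rmorphD rmorphM ev_f mulr0 add0r.
move: detH; rewrite ev_r (evE _ _ r_size) !big_ord_recr big_ord0 /= add0r expr0 expr1.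
move: r`_0 r`_1 r`_2 r`_3 => a b c d detH.
have det_norm : \det H * (\det H)^* = 11 ^+ 11.
  have /(congr1 determinant) := H_unitary; rewrite det_mulmx det_scalar.
  by rewrite det_map_mx det_tr.
have z_conj : z^* = z - z ^+ 3.
  rewrite (conj_unity_root (isT : 0 < 12)%N (prim_expr_order z_prim)).
  have z_neq0 : z != 0 by rewrite (prim_root_eq0 z_prim).
  apply: (mulfI z_neq0); rewrite divff // mulrBr -exprS z4; ring.
pose A := a ^+ 2 + b ^+ 2 + c ^+ 2 + d ^+ 2 + a * c + b * d.
pose B := a * b + b * c + c * d.
have z2_conj : (z ^+ 2)^* = 1 - z ^+ 2.
  rewrite rmorphXn /= z_conj.
  transitivity (z ^+ 2 * (z ^+ 4 - 2 * z ^+ 2 + 1)); first by ring.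
  rewrite {1}z4; transitivity (- z ^+ 4); first by ring.
  by rewrite z4; ring.
have z3_conj : (z ^+ 3)^* = - z ^+ 3.
  rewrite exprS rmorphM /= z_conj z2_conj.
  transitivity (z * (z ^+ 4 - 2 * z ^+ 2 + 1)); first by ring.
  by rewrite z4; ring.
(* [2 z - z^3 = z + z^-1] is a square root of 3; its coefficient in the norm is [B]. *)
have norm : (A - 11 ^+ 11)%:~R + (2 * B)%:~R * z - B%:~R * z ^+ 3 = 0.
  transitivity (\det H * (\det H)^* - 11 ^+ 11); last by rewrite det_norm subrr.
  have conj_int (k : int) (y : C) : (k%:~R * y)^* = k%:~R * y^*.
    by rewrite rmorphM /= rmorph_int.
  have -> : (A - 11 ^+ 11)%:~R = A%:~R - 11 ^+ 11 :> C.
    by rewrite intrB rmorphXn.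
  move: (11 ^+ 11 : C) => N.
  have -> : (\det H)^* =
      a%:~R + b%:~R * (z - z ^+ 3) + c%:~R * (1 - z ^+ 2) + d%:~R * - z ^+ 3.
    by rewrite detH !rmorphD /= !conj_int z2_conj z3_conj z_conj rmorph1 mulr1.
  rewrite detH /A /B !(intrD, intrM, rmorphXn) /=.
  move: a%:~R b%:~R c%:~R d%:~R => a' b' c' d'; apply/esym.
  pose k0 := - b' ^+ 2 - c' ^+ 2 - b' * d' - d' ^+ 2.
  pose k1 := - b' * c' - 2 * c' * d'; pose k2 := - b' * d' - d' ^+ 2.
  apply/eqP; rewrite -subr_eq0; apply/eqP.
  transitivity ((z ^+ 4 - (z ^+ 2 - 1)) * (k0 + k1 * z + k2 * z ^+ 2)).
    by rewrite /k0 /k1 /k2; ring.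
  by rewrite z4 subrr mul0r.
pose P : {poly int} := Poly [:: A - 11 ^+ 11; 2 * B; 0; - B].
have P0 : P = 0.
  apply: (int_poly_prim_root_eq0 z_prim); first exact: size_Poly.
  rewrite rootE -[X in _ == X]norm; apply/eqP.
  transitivity (ev P); first by [].
  rewrite (@evE _ 4) ?size_Poly // !big_ord_recr big_ord0 /= !coef_Poly /=.
  by rewrite rmorphN /=; ring.
have A11 : A = 11 ^+ 11.
  by have := congr1 (fun Q : {poly int} => Q`_0) P0; rewrite coef_Poly coef0 => /subr0_eq.
apply: (no_norm_11_odd A11); rewrite -/B.
by have := congr1 (fun Q : {poly int} => Q`_3) P0; rewrite coef_Poly coef0 /=; lia.
Qed.
End Twelve.

(** * Reduction of q = 14 to symmetric exponents *)

Lemma sign_dot_flip (n : nat) (s : 'I_n -> 'I_n -> bool) (c : 'I_n -> bool) i j :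
  sign_dot (fun i k => c i (+) s i k) i j = (-1) ^+ c i * (-1) ^+ c j * sign_dot s i j.
Proof.
rewrite /sign_dot mulr_sumr; apply: eq_bigr => k _; rewrite !signr_addb; ring.
Qed.

(** By parity the three inner products of any triple have positive product, so the signs of the
    products with row 0 determine all others. *)
Lemma sign_dot_pm7_switch (s : 'I_11 -> 'I_11 -> bool) :
  (forall i j, i != j -> exists t, sign_dot s i j = 7 * t) ->
  exists c : 'I_11 -> bool,
    forall i j, i != j -> sign_dot s i j = 7 * ((-1) ^+ c i * (-1) ^+ c j).
Proof.
move=> dot7.
have pm i j : i != j -> sign_dot s i j = 7 \/ sign_dot s i j = -7.
  move=> /dot7[t]; have [d d_le ->] := sign_dot_card s i j; lia.
exists (fun i => (i != ord0) && (sign_dot s ord0 i < 0)) => i j ij.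
have [i0|i_neq0] := eqVneq i ord0.
  rewrite i0 in ij *; rewrite [j == _]eq_sym ij /=.
  by have [->|->] := pm _ _ ij.
have [j0|j_neq0] := eqVneq j ord0.
  rewrite j0 eq_sym in ij *; rewrite sign_dotC /=.
  by have [->|->] := pm _ _ ij.
have [u] := sign_dot_triple s ord0 i j; rewrite /=.
rewrite eq_sym in i_neq0; rewrite eq_sym in j_neq0.
by have [->|->] := pm _ _ i_neq0; have [->|->] := pm _ _ j_neq0;
   have [->|->] := pm _ _ ij; rewrite /=; lia.
Qed.

Lemma sign_sum_card (n : nat) (b : 'I_n -> bool) (R : nzRingType) :
  \sum_i (-1) ^+ b i = n%:R - #|b|%:R *+ 2 :> R.
Proof.
have -> : n%:R = \sum_(k < n) 1 :> R by rewrite sumr_const card_ord.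
have -> : #|b|%:R = \sum_(k < n) (b k)%:R :> R.
  rewrite -sum1_card natr_sum big_mkcond /=; apply: eq_bigr => k _.
  by rewrite unfold_in; case: (b k).
rewrite -sumrMnl -sumrB; apply: eq_bigr => k _.
by case: (b k) => /=; rewrite ?mul0rn ?subr0 // expr1 mulr2n opprD addrA subrr add0r.
Qed.

(** The squared column length 11 forces column sums 9 or -9, so each column has one exceptional
    sign. Two columns with the same exceptional row would have inner product 11 or -11 instead of 7
    or -7. *)
Lemma sign_dot_7_structure (s : 'I_11 -> 'I_11 -> bool) :
  (forall i j, i != j -> sign_dot s i j = 7) ->
  exists (c : 'I_11 -> bool) (r : 'I_11 -> 'I_11),
    injective r /\ forall i k, c k (+) s i k = (i == r k).
Proof.
move=> dot7; pose M : 'M[rat]_11 := \matrix_(i, k) (-1) ^+ s i k.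
have MM : M *m M^T = 4%:M + const_mx 7.
  apply/matrixP => i j; rewrite !mxE.
  rewrite (eq_bigr (fun k => ((-1) ^+ s i k * (-1) ^+ s j k)%:~R)); last first.
    by move=> k _; rewrite !mxE intrM !rmorph_sign.
  rewrite -rmorph_sum -/(sign_dot s i j).
  have [<-|ij] := eqVneq i j; last by rewrite dot7 //= mulr0n add0r.
  rewrite /sign_dot (eq_bigr (fun=> 1)) ?sumr_const ?card_ord //=.
  by move=> k _; rewrite -expr2 sqrr_sign.
pose n k := #|(fun i => s i k) : pred 'I_11|.
have M_sum k : \sum_i M i k = 11 - (n k)%:R *+ 2.
  by rewrite -[RHS]sign_sum_card; apply: eq_bigr => i _; rewrite mxE.
have MM' k l : \sum_i M i k * M i l =
    4 *+ (k == l) + 7 / 81 * (11 - (n k)%:R *+ 2) * (11 - (n l)%:R *+ 2).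
  have MT_sum : \sum_i M^T k i = 11 - (n k)%:R *+ 2.
    by rewrite -M_sum; apply: eq_bigr => i _; rewrite !mxE.
  have := mulmx_scalar_const MM _ _ k l; rewrite MT_sum M_sum.
  have -> : 4 + 11%:R * 7 = 81 :> rat by [].
  by move=> <- //; apply: eq_bigr => i _; rewrite !mxE.
have n_cases k : n k = 1%N \/ n k = 10%N.
  have : (11 - (n k)%:R *+ 2) ^+ 2 = 81 :> rat.
    have := MM' k k; rewrite (eq_bigr (fun=> 1)) => [|i _]; last first.
      by rewrite !mxE -expr2 sqrr_sign.
    rewrite sumr_const card_ord eqxx mulr1n; lra.
  move=> sq; have : (1%:R - (n k)%:R) * (10 - (n k)%:R) = 0 :> rat by lra.
  move=> /eqP; rewrite mulf_eq0 => /orP[] /eqP/subr0_eq/eqP.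
    by rewrite eqr_nat => /eqP; left.
  by rewrite eqr_nat => /eqP; right.
pose c k := n k == 10%N.
have c_card k : #|[pred i | c k (+) s i k]| = 1%N.
  have [nk|nk] := n_cases k; rewrite /c nk /=.
    by rewrite -[RHS]nk; apply: eq_card.
  have := cardC (fun i => s i k); rewrite card_ord -/(n k) nk => /(@addnI 10 _ 1) nC.
  by rewrite -[RHS]nC; apply: eq_card.
have ex_r k : exists i, [pred i | c k (+) s i k] =i pred1 i.
  have /eqP/card1P[i iP] := c_card k; by exists i.
have [r rP] := fin_all_exists ex_r.
have sE i k : c k (+) s i k = (i == r k) by have := rP k i; rewrite !inE.
exists c, r; split=> // k l r_kl; apply/eqP/idPn => kl.
have := MM' k l; rewrite (negbTE kl) mulr0n add0r.
rewrite (eq_bigr (fun=> (-1) ^+ (c k (+) c l))); last first.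
  move=> i _; rewrite !mxE -signr_addb; congr (_ ^+ _).
  have := sE i k; rewrite r_kl -sE.
  by case: (c k); case: (c l); case: (s i k); case: (s i l).
rewrite sumr_const card_ord.
by case: (c k (+) c l); have [->|->] := n_cases k; have [->|->] := n_cases l; lra.
Qed.

(* The counts run over all [k], diagonal included: [k = i] and [k = j] contribute
   the differences [- f i j] and [f i j], and [k = i] contributes a letter [0],
   which is why [0] is the only letter of odd multiplicity. *)
Definition symmetric_exponents (f : 'I_11 -> 'I_11 -> 'I_7) : Prop :=
  [/\ forall i, f i i = 0,
      forall i j, f i j = f j i,
      forall i j, i != j -> forall x, #|[pred k | f i k - f j k == x]| =
        (1 + 2 * (x == f i j) + 2 * (x == (- f i j)%R))%N
    & forall i x, odd #|[pred k | f i k == x]| = (x == 0)].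

(** Swapping coordinates pairs off the pairs outside the diagonal. *)
Lemma odd_card_symmetric (I : finType) (J : eqType) (g : I -> I -> J) (x : J) :
  (forall i j, g i j = g j i) ->
  odd (\sum_i #|[pred j | g i j == x]|) = odd #|[pred i | g i i == x]|.
Proof.
move=> g_sym.
have -> : (\sum_i #|[pred j | g i j == x]| = #|[set p : I * I | g p.1 p.2 == x]|)%N.
  rewrite -sum1_card (eq_bigl (fun p : I * I => g p.1 p.2 == x)); last first.
    by move=> p; rewrite inE.
  rewrite -(pair_big_dep xpredT (fun i j => g i j == x) (fun _ _ => 1%N)) /=.
  by apply: eq_bigr => i _; rewrite -sum1_card.
set A := [set p | _].
pose D := [set p in A | p.1 == p.2].
pose L := [set p in A | (enum_rank p.1 < enum_rank p.2)%N].
pose U := [set p in A | (enum_rank p.2 < enum_rank p.1)%N].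
have UL : #|U| = #|L|.
  pose sw (p : I * I) := (p.2, p.1).
  have sw_inj : injective sw by case=> [a b] [c d] [-> ->].
  rewrite -(card_imset _ sw_inj); apply: eq_card => -[a b].
  rewrite !inE /=; apply/imsetP/andP => [[[c d]]|[gab ab]].
    by rewrite !inE /= => /andP[gcd cd] [-> ->]; rewrite g_sym gcd.
  by exists (b, a); rewrite // !inE /= g_sym gab.
have D_card : #|D| = #|[pred i | g i i == x]|.
  pose dg (i : I) := (i, i).
  have dg_inj : injective dg by move=> a b [].
  rewrite -(card_image dg_inj [pred i | g i i == x]); apply: eq_card => -[a b].
  rewrite !inE /=; apply/andP/imageP => [[gab /eqP ab]|[c gc [-> ->]]].
    by exists a; rewrite ?inE ab // -{1}ab.
  by rewrite eqxx.
have -> : #|A| = (#|D| + (#|L| + #|U|))%N.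
  have -> : A = D :|: (L :|: U).
    apply/setP => -[a b]; rewrite !inE /= -!andb_orr.
    have [->|ab] := eqVneq a b; first by rewrite andbT.
    by rewrite -neq_ltn (inj_eq val_inj) (inj_eq enum_rank_inj) ab andbT.
  rewrite !cardsU; have -> : L :&: U = set0.
    apply/setP => -[a b]; rewrite !inE /=.
    by case: (ltngtP (enum_rank a) (enum_rank b)); rewrite ?andbF.
  have -> : D :&: (L :|: U) = set0.
    apply/setP => -[a b]; rewrite !inE /=.
    by have [->|] := eqVneq a b; rewrite ?ltnn ?andbF.
  by rewrite cards0 !subn0.
by rewrite UL addnn oddD odd_double addbF D_card.
Qed.

Lemma sum_indicator (J : finType) (R : nzRingType) (g : J -> R) (u v : J) :
  \sum_x g x *+ (1 + 2 * (x == u) + 2 * (x == v)) =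
    \sum_x g x + g u *+ 2 + g v *+ 2.
Proof.
have delta (w : J) : \sum_x g x *+ (2 * (x == w)) = g w *+ 2.
  by rewrite (bigD1 w) //= eqxx muln1 big1 ?addr0 // => x /negbTE ->; rewrite muln0.
under eq_bigr => x _ do rewrite mulrnDr mulrnDr mulr1n.
by rewrite !big_split /= !delta.
Qed.

Lemma sum_ord7 (R : nzRingType) (g : 'I_7 -> R) :
  let o k lt_k := g (@Ordinal 7 k lt_k) in
  \sum_x g x = o 0 isT + o 1 isT + o 2 isT + o 3 isT + o 4 isT + o 5 isT + o 6 isT.
Proof.
rewrite !big_ord_recr big_ord0 /= add0r.
by congr (g _ + g _ + g _ + g _ + g _ + g _ + g _); apply: val_inj.
Qed.

Lemma sub_shift_eq (V : zmodType) (p u r w x : V) :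
  (p - r == x + u - w) = (p - u - (r - w) == x).
Proof.
rewrite !subr_eq -!addrA; congr (_ == _ + _).
by rewrite addrCA [RHS]addrCA (addrC r u).
Qed.

Lemma sub_add_eq (V : zmodType) (p u r w x : V) :
  (p + u - (r + w) == x) = (p - r == x - (u - w)).
Proof.
rewrite !subr_eq -[RHS](inj_eq (addIr u)); congr (_ == _).
by rewrite opprB -!addrA [r + u]addrC addKr [w + r]addrC.
Qed.

Lemma mulr7_eq0 (u : 'I_7) : u *+ 7 = 0.
Proof. by rewrite Zp_mulrn; apply: val_inj; rewrite /= modnMl. Qed.

Lemma parity_of_counts (f : 'I_11 -> 'I_11 -> 'I_7) :
  (forall i, f i i = 0) -> (forall i j, f i j = f j i) ->
  (forall i j, i != j -> forall x, #|[pred k | f i k - f j k == x]| =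
        (1 + 2 * (x == f i j) + 2 * (x == (- f i j)%R))%N) ->
  forall v y, odd #|[pred k | f v k == y]| = (y == 0).
Proof.
move=> f_diag f_sym f_count v y.
(* [g] is symmetric, so the number of pairs with [g k l = x] has the parity of
   the number of diagonal ones, and [g k k = - 2 (f v k)]. *)
pose g k l := f k l - f v k - f v l; pose x := - (y *+ 2).
have mul2_inj (a b : 'I_7) : (a *+ 2 == b *+ 2) = (a == b).
  apply/eqP/eqP => [/(congr1 (fun u : 'I_7 => u *+ 4))|-> //].
  by rewrite -!mulrnA -[(2 * 4)%N]/7.+1 !(mulrS _ 7) !mulr7_eq0 !addr0.
have g_sym k l : g k l = g l k by rewrite /g f_sym addrAC.
have := odd_card_symmetric x g_sym.
have -> : #|[pred i | g i i == x]| = #|[pred k | f v k == y]|.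
  apply: eq_card => k; rewrite !inE /g f_diag sub0r -opprD -mulr2n /x.
  by rewrite eqr_opp mul2_inj.
move=> <-; rewrite (bigD1 v) //= oddD.
(* Row [v] of [g] is zero; below, each of the ten other rows contributes an odd count. *)
have -> : #|[pred j | g v j == x]| = (11 * (y == 0%R))%N.
  rewrite (eq_card (B := [pred j | y == 0])); last first.
    move=> j; rewrite !inE /g f_diag subr0 subrr /x eq_sym oppr_eq0.
    by rewrite -(mul0rn _ 2) mul2_inj.
  by case: (y == 0); rewrite ?muln1 ?muln0 ?card_ord // card0.
have -> : odd (\sum_(i < 11 | i != v) #|[pred j | g i j == x]|) = false.
  rewrite (eq_bigr (fun k => 1 + 2 * (((x + f v k)%R == f k v) +
      ((x + f v k)%R == (- f k v)%R))))%N.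
    by rewrite big_split -big_distrr /= sum_nat_const cardC1 card_ord oddD !oddM.
  move=> k kv; rewrite mulnDr addnA -f_count //; apply: eq_card => l.
  by rewrite !inE /g addrAC subr_eq.
by rewrite oddM addbF; case: (y == 0).
Qed.

(* Conjugating by a diagonal matrix moves the antisymmetric part [f i j - f j i]
   by [2 (d i - d j)]; comparing first moments shows that it is itself a
   difference of row sums, so it can be removed. *)
Lemma symmetric_exponents_exist (s : 'I_11 -> 'I_11 -> bool)
    (a : 'I_11 -> 'I_11 -> 'I_7) :
  (forall i j, i != j -> exists t : int, forall x,
     \sum_(k | a i k - a j k == x) (-1) ^+ s i k * (-1) ^+ s j k = t) ->
  exists f, symmetric_exponents f.
Proof.
move=> count_t.
have [i j ij|c cP] := @sign_dot_pm7_switch s.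
  by have [t /sign_dot_count ->] := count_t i j ij; exists t.
have [i j ij|e [r [r_inj rP]]] :=
    @sign_dot_7_structure (fun i k => c i (+) s i k).
  rewrite sign_dot_flip cP //.
  by case: (c i); case: (c j).
have sE i k : (-1) ^+ s i k = (-1) ^+ c i * (-1) ^+ e k * (-1) ^+ (i == r k) :> int.
  rewrite -rP !signr_addb.
  by case: (c i); case: (e k); case: (s i k).
have {}count_t i j x : i != j ->
    \sum_(k | a i k - a j k == x) (-1) ^+ (i == r k) * (-1) ^+ (j == r k) = 1 :> int.
  move=> ij; have [t tP] := count_t i j ij.
  have t_val : t = (-1) ^+ c i * (-1) ^+ c j.
    have := sign_dot_count tP; rewrite (cP _ _ ij) => /(@mulfI _ 7 _ _ _) -> //.
  have := tP x; rewrite t_val.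
  move=> /(congr1 (fun u => (-1) ^+ c i * (-1) ^+ c j * u)).
  rewrite mulr_sumr mulrACA -!expr2 !sqrr_sign mulr1 => tE; rewrite -[RHS]tE.
  apply: eq_bigr => k _; rewrite !sE.
  by case: (c i); case: (c j); case: (e k); case: (_ == _); case: (_ == _).
(* [q] moves the exceptional sign of row [i] to column [i]. *)
pose q := invF r_inj.
pose b i j := a i (q j) - a i (q i).
have b_diag i : b i i = 0 by rewrite /b subrr.
have b_count i j x : i != j -> #|[pred k | b i k - b j k == x]| =
    (1 + 2 * (x == b i j) + 2 * (x == (- b j i)%R))%N.
  move=> ij; have := count_t i j (x + a i (q i) - a j (q j)) ij.
  rewrite (reindex_inj (can_inj (f_invF r_inj))) /=.
  rewrite (eq_bigl (fun k => b i k - b j k == x)); last first.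
    by move=> k; rewrite sub_shift_eq.
  (* The sign product is -1 only at [k = i] and [k = j], where the differences are [- b j i] and
     [b i j]. *)
  rewrite (eq_bigr (fun k => 1 - (i == k)%:R *+ 2 - (j == k)%:R *+ 2)); last first.
    move=> k _; rewrite f_invF; case: (eqVneq i k) => [ik|_].
      by rewrite -ik eq_sym (negbTE ij).
    by case: (j == k).
  rewrite !sumrB sumr_const !sumrMnl.
  have delta (l : 'I_11) (P : pred 'I_11) :
      \sum_(k | P k) (l == k)%:R = (P l)%:R :> int.
    rewrite big_mkcond (bigD1 l) //= eqxx big1 ?addr0 => [|k kl].
      by case: (P l).
    by rewrite eq_sym (negbTE kl); case: ifP.
  rewrite !delta !b_diag sub0r subr0 (eq_sym (- b j i)) (eq_sym (b i j)).
  rewrite (@eq_card _ _ [pred k | b i k - b j k == x]) // natz.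
  by case: (x == b i j); case: (x == - b j i) => /=; lia.
pose R i := \sum_k b i k.
(* The residues modulo 7 sum to 0, so only the doubled terms remain. *)
have moment i j : i != j -> R i - R j = (b i j - b j i) *+ 2.
  move=> ij; rewrite -sumrB (sum_card_val id).
  under eq_bigr => x _ do rewrite b_count //.
  rewrite (sum_indicator id) (sum_ord7 id) /= [X in X + _ + _](_ : _ = 0).
    by rewrite add0r -mulrnDl.
  exact: val_inj.
(* 5 is [-1/4] modulo 7: [f i j - f j i] becomes [21 (b i j - b j i) = 0]. *)
pose f i j := b i j + (R i - R j) *+ 5.
exists f; have f_diag i : f i i = 0 by rewrite /f subrr mul0rn b_diag addr0.
have f_sym i j : f i j = f j i.
  have [->//|ij] := eqVneq i j.
  rewrite /f -[R j - R i]opprB moment // -{1}[b i j](subrK (b j i)).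
  move: (b i j - b j i) => d; rewrite mulNrn -!mulrnA addrAC [RHS]addrC.
  congr (_ + _); apply/eqP; rewrite -subr_eq0 opprK -mulrS -mulrnDr.
  by rewrite -[(_ + _)%N]/(7 * 3)%N mulrnA mulr7_eq0 mul0rn.
have f_count i j x : i != j -> #|[pred k | f i k - f j k == x]| =
    (1 + 2 * (x == f i j) + 2 * (x == (- f i j)%R))%N.
  have f_opp : - f i j = - b j i + (R i - R j) *+ 5.
    by rewrite f_sym /f opprD -mulNrn (opprB (R j)).
  move=> ij; rewrite f_opp /f -[x == b i j + _]subr_eq -[x == - b j i + _]subr_eq.
  rewrite -b_count //; apply: eq_card.
  move=> k; rewrite !inE /f sub_add_eq -mulrnBl.
  by have -> : R i - R k - (R j - R k) = R i - R j by rewrite opprB addrA subrK.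
split=> // [i j ij x|]; first exact: f_count.
by apply: parity_of_counts => // i j ij x; apply: f_count.
Qed.

(** * Exhaustive search for symmetric exponents *)

Section Search.
Local Open Scope nat_scope.

Definition sub7_table : seq (seq nat) :=
  Eval vm_compute in mkseq (fun x => mkseq (fun y => (x + (7 - y)) %% 7) 7) 7.

Definition sub7 (x y : nat) : nat := nth 0 (nth [::] sub7_table x) y.

Fixpoint dec (d : nat) (c : seq nat) : option (seq nat) :=
  match c, d with
  | [::], _ => None
  | n :: c', 0 => if n is n'.+1 then Some (n' :: c') else None
  | n :: c', d'.+1 => if dec d' c' is Some r then Some (n :: r) else None
  end.

Fixpoint flip (d : nat) (b : seq bool) : seq bool :=
  match b, d with
  | [::], _ => [::]
  | x :: b', 0 => ~~ x :: b'
  | x :: b', d'.+1 => x :: flip d' b'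
  end.

Fixpoint step (x : nat) (st : seq (seq (seq nat) * seq nat)) :
    option (seq (seq (seq nat) * seq nat)) :=
  match st with
  | [::] => Some [::]
  | (r, c) :: st' =>
    if dec (nth 0 (head [::] r) x) c is Some c' then
      if step x st' is Some t then Some ((behead r, c') :: t) else None
    else None
  end.

(* Enumerates the words [w] with [w_j] in the [j]-th list of [cols] (and
   [w_(j-1) <= w_j] when the flag of that column is set), such that the
   differences with each row of [st] fit in the counter stored with that row,
   and such that the letters with odd multiplicity are those marked in [par];
   each row of [st] is stored as the list of its rows of [sub7_table].
   The result tells whether the continuation [k] holds of all these words. *)
Fixpoint search_row (cols : seq (bool * seq nat)) (prev : nat)
    (st : seq (seq (seq nat) * seq nat)) (par : seq bool) (acc : seq nat)
    (k : seq nat -> bool) : bool :=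
  match cols with
  | [::] => if has id par then true else k (rev acc)
  | (ordered, xs) :: cols' =>
    all (fun x =>
      if (if ordered then x < prev else false) then true
      else if step x st is Some st' then
        search_row cols' x st' (flip x par) (x :: acc) k
      else true) xs
  end.

(** The multiplicities that [symmetric_exponents] prescribes when [f i j = c]. *)
Definition counter (c : nat) : seq nat :=
  [seq 1 + 2 * (d == c) + 2 * (d == sub7 0 c) | d <- iota 0 7].

(** Symmetry fixes the first [m] entries of row [m], and its entry against an earlier row selects
    the counter for that row. *)
Definition next_row (flags : seq bool) (rows : seq (seq nat))
    (k : seq nat -> bool) : bool :=
  let m := size rows in
  let cols := [seq (nth false flags j,
      if j < m then [:: nth 0 (nth [::] rows j) m]
      else if j == m then [:: 0] else iota 0 7) | j <- iota 0 11] in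
  search_row cols 0
    [seq ([seq nth [::] sub7_table y | y <- r], counter (nth 0 r m)) | r <- rows]
    [:: true; false; false; false; false; false; false] [::] k.

(** Fuel runs out only when all the rows asked for were found, hence [false]. *)
Fixpoint refute (fuel : nat) (rows : seq (seq nat)) : bool :=
  if fuel is fuel'.+1 then
    next_row [::] rows (fun row => refute fuel' (rcons rows row))
  else false.

(** Columns with equal entries in the first row are interchangeable, so the second row may increase
    weakly on each such block. Columns 0 and 1 stay fixed, whence [2 < j]. Three further rows make
    five. *)
Definition refute_row (row : seq nat) : bool :=
  next_row [seq (2 < j) && (nth 0 row j.-1 == nth 0 row j) | j <- iota 0 11]
    [:: row] (fun row1 => refute 3 [:: row; row1]).

(* Up to scaling by units of F_7 and sorting, the first row consists of [0]
   followed by each letter of [h], twice; [c] is the entry placed first. *)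
Definition first_rows : seq (nat * seq nat) := [::
  (0, [:: 0; 0; 0; 0; 0]); (1, [:: 0; 0; 0; 0; 1]); (3, [:: 0; 0; 0; 3; 3]);
  (2, [:: 0; 0; 0; 1; 2]); (3, [:: 0; 0; 0; 2; 3]); (4, [:: 0; 0; 0; 3; 4]);
  (0, [:: 0; 0; 1; 1; 1]); (4, [:: 0; 0; 2; 2; 4]); (3, [:: 0; 0; 1; 1; 3]);
  (4, [:: 0; 0; 1; 1; 4]); (5, [:: 0; 0; 1; 1; 5]); (4, [:: 0; 0; 3; 3; 4]);
  (5, [:: 0; 0; 1; 3; 5]); (4, [:: 0; 0; 1; 2; 4]); (4, [:: 0; 0; 1; 4; 6]);
  (4, [:: 0; 0; 3; 4; 6]); (0, [:: 0; 1; 1; 1; 1]); (2, [:: 0; 1; 1; 1; 2]);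
  (0, [:: 0; 4; 4; 4; 5]); (0, [:: 0; 1; 1; 1; 4]); (0, [:: 0; 4; 4; 4; 6]);
  (0, [:: 0; 2; 2; 2; 5]); (0, [:: 0; 1; 1; 4; 4]); (6, [:: 0; 2; 3; 3; 6]);
  (0, [:: 0; 3; 3; 5; 6]); (0, [:: 0; 2; 2; 3; 4]); (6, [:: 0; 1; 1; 2; 6]);
  (0, [:: 0; 4; 4; 6; 6]); (0, [:: 0; 1; 1; 3; 4]); (0, [:: 0; 2; 2; 3; 6]);
  (6, [:: 0; 2; 2; 5; 6]); (5, [:: 0; 1; 1; 4; 5]); (0, [:: 0; 3; 3; 4; 5]);
  (0, [:: 0; 2; 2; 3; 5]); (0, [:: 0; 3; 3; 4; 4]); (6, [:: 0; 1; 2; 4; 6]);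
  (6, [:: 0; 2; 4; 5; 6]); (6, [:: 0; 1; 3; 4; 6]); (1, [:: 1; 1; 1; 1; 1]);
  (2, [:: 1; 1; 1; 1; 2]); (3, [:: 1; 1; 1; 1; 3]); (4, [:: 1; 1; 1; 1; 4]);
  (5, [:: 1; 1; 1; 1; 5]); (6, [:: 1; 1; 1; 1; 6]); (2, [:: 1; 1; 1; 2; 2]);
  (4, [:: 2; 2; 2; 4; 6]); (4, [:: 1; 1; 1; 2; 4]); (2, [:: 1; 1; 1; 2; 5]);
  (6, [:: 3; 3; 3; 4; 6]); (3, [:: 1; 1; 1; 3; 3]); (4, [:: 1; 1; 1; 3; 4]);
  (5, [:: 1; 1; 1; 3; 5]); (6, [:: 2; 2; 2; 5; 6]); (4, [:: 1; 1; 1; 4; 4]);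
  (5, [:: 1; 1; 1; 4; 5]); (4, [:: 1; 1; 1; 4; 6]); (5, [:: 1; 1; 1; 5; 5]);
  (3, [:: 2; 2; 2; 3; 5]); (4, [:: 3; 3; 3; 4; 4]); (5, [:: 1; 1; 4; 4; 5]);
  (4, [:: 1; 1; 2; 2; 4]); (5, [:: 1; 1; 2; 2; 5]); (5, [:: 2; 2; 4; 4; 5]);
  (6, [:: 2; 2; 3; 3; 6]); (4, [:: 1; 1; 2; 3; 4]); (5, [:: 1; 1; 2; 3; 5]);
  (5, [:: 1; 3; 4; 4; 5]); (5, [:: 1; 1; 2; 4; 5]); (5, [:: 1; 2; 2; 4; 5]);
  (4, [:: 2; 2; 3; 3; 4]); (5, [:: 1; 1; 2; 5; 6]); (6, [:: 3; 3; 4; 4; 6]);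
  (4, [:: 1; 1; 3; 3; 4]); (5, [:: 1; 1; 3; 3; 5]); (5, [:: 1; 1; 3; 4; 5]);
  (4, [:: 1; 1; 3; 4; 6]); (6, [:: 2; 2; 3; 5; 6]); (6, [:: 2; 2; 5; 5; 6]);
  (4, [:: 1; 1; 4; 5; 6]); (5, [:: 1; 2; 3; 4; 5])
  ].

Definition double_letters (h : seq nat) : seq nat := flatten [seq [:: x; x] | x <- h].

Definition mul7 (a x : nat) : nat := (x * a) %% 7.

Definition covered (row : seq nat) : bool :=
  has (fun a => let s := sort leq (map (mul7 a) (behead row)) in
    has (fun ch => (ch.1 \in ch.2) && (double_letters ch.2 == s)) first_rows)
  (iota 1 6).

Definition first_row (ch : nat * seq nat) : seq nat :=
  0 :: ch.1 :: rem ch.1 (double_letters ch.2).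

Lemma covered_all : next_row [seq 1 < j | j <- iota 0 11] [::] covered.
Proof. by vm_compute. Qed.

Lemma refute_all : all (fun ch => refute_row (first_row ch)) first_rows.
Proof. by vm_compute. Qed.
End Search.

(** * Soundness of the search *)

Section SearchSound.
Local Open Scope nat_scope.

Lemma dec_some (d : nat) (c : seq nat) : 0 < nth 0 c d ->
  exists2 c', dec d c = Some c' & forall x, nth 0 c x = (x == d) + nth 0 c' x.
Proof.
elim: c d => [|n c IHc] [|d] //=.
  by case: n => // n _; exists (n :: c) => // -[|x].
by move=> /IHc[c' -> cE]; exists (n :: c') => // -[|x] /=.
Qed.

Lemma size_flip (d : nat) (b : seq bool) : size (flip d b) = size b.
Proof. by elim: b d => [|x b IHb] [|d] //=; rewrite IHb. Qed.

Lemma nth_flip (d : nat) (b : seq bool) (x : nat) : d < size b ->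
  nth false (flip d b) x = (d == x) (+) nth false b x.
Proof. by elim: b d x => [|y b IHb] [|d] [|x] //=; rewrite ltnS => /IHb ->. Qed.

(** The search invariant: the unread letters [ws] use no difference more often than the counter
    still allows. *)
Definition fits (rc : seq (seq nat) * seq nat) (ws : seq nat) : Prop :=
  size rc.1 = size ws /\
  forall d, count_mem d [seq nth 0 p.1 p.2 | p <- zip rc.1 ws] <= nth 0 rc.2 d.

Lemma step_some (st : seq (seq (seq nat) * seq nat)) (w : nat) (ws : seq nat) :
  (forall rc, rc \in st -> fits rc (w :: ws)) ->
  exists2 st', step w st = Some st' & forall rc, rc \in st' -> fits rc ws.
Proof.
elim: st => [|[r c] st IHst] st_fits; first by exists [::].
have [] := st_fits _ (mem_head _ _).
case: r st_fits => [//|t r] st_fits /= [szr] r_fits.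
have [|c' -> c'E] := @dec_some (nth 0 t w) c.
  by apply: leq_trans (r_fits _); rewrite eqxx.
have [rc rc_st|st' -> st'_fits] := IHst.
  by apply: st_fits; rewrite inE rc_st orbT.
exists ((r, c') :: st') => // rc; rewrite inE => /orP[/eqP ->|/st'_fits //].
split=> //= d; rewrite -(leq_add2l (d == nth 0 t w)) -c'E eq_sym.
exact: r_fits.
Qed.

Fixpoint admissible (cols : seq (bool * seq nat)) (prev : nat) (ws : seq nat) :=
  match cols, ws with
  | [::], [::] => true
  | (ordered, xs) :: cols', w :: ws' =>
    [&& w \in xs, ordered ==> (prev <= w) & admissible cols' w ws']
  | _, _ => false
  end.

(** A word meeting all constraints is never pruned, so [k] is evaluated at it. *)
Lemma search_rowP (cols : seq (bool * seq nat)) (prev : nat)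
    (st : seq (seq (seq nat) * seq nat)) (par : seq bool) (acc ws : seq nat)
    (k : seq nat -> bool) :
  admissible cols prev ws -> all (fun w => w < size par) ws ->
  (forall rc, rc \in st -> fits rc ws) ->
  (forall x, odd (count_mem x ws) = nth false par x) ->
  search_row cols prev st par acc k -> k (rev acc ++ ws).
Proof.
elim: cols prev st par acc ws => [|[ordered xs] cols IHcols] prev st par acc.
  case=> //= _ _ _ par_odd; rewrite cats0.
  case: hasP => // -[b /(nthP false)[x _ <-]] /=.
  by rewrite -par_odd.
case=> //= w ws /and3P[w_xs ord_w adm] /andP[w_par ws_par] st_fits par_odd.
move=> /allP/(_ w w_xs); have -> : (if ordered then w < prev else false) = false.
  by case: ordered ord_w => //= prev_le; rewrite ltnNge prev_le.
have [st' -> st'_fits] := step_some st_fits.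
move=> /(IHcols _ _ _ _ ws adm); rewrite size_flip rev_cons cat_rcons.
apply=> // x; rewrite nth_flip // -par_odd oddD.
by case: (w == x); case: (odd _).
Qed.

Lemma admissible_nth (cols : seq (bool * seq nat)) (prev : nat) (ws : seq nat) :
  size ws = size cols ->
  (forall j, j < size cols -> nth 0 ws j \in (nth (false, [::]) cols j).2) ->
  (forall j, j < size cols -> (nth (false, [::]) cols j).1 ->
     nth 0 (prev :: ws) j <= nth 0 ws j) ->
  admissible cols prev ws.
Proof.
elim: cols prev ws => [|[ordered xs] cols IHcols] prev [|w ws] //= [sz] mem_ws ord_ws.
apply/and3P; split; first exact: (mem_ws 0).
  by apply/implyP => /(ord_ws 0 isT).
apply: IHcols => // j j_lt; first exact: (mem_ws j.+1).
exact: (ord_ws j.+1).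
Qed.

Lemma sub7E (x y : 'I_7) : sub7 x y = (x - y)%R.
Proof.
have -> : sub7 x y = (x + (7 - y)) %% 7.
  rewrite /sub7 -[sub7_table]/(mkseq (fun x => mkseq (fun y => (x + (7 - y)) %% 7) 7) 7).
  by rewrite !nth_mkseq.
by rewrite /= modnDmr.
Qed.

Variables (f : 'I_11 -> 'I_11 -> 'I_7) (vs : seq 'I_11).
Hypotheses (f_good : symmetric_exponents f) (vs_enum : perm_eq vs (enum 'I_11)).

Let e (i : nat) : 'I_11 := nth ord0 vs i.
(** One permutation reorders rows and columns, preserving symmetry and the zero diagonal. *)
Definition row_of (i : nat) : seq nat := [seq nat_of_ord (f (e i) k) | k <- vs].

Lemma size_vs : size vs = 11.
Proof. by rewrite (perm_size vs_enum) size_enum_ord. Qed.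

Lemma nth_row_of (i j : nat) : j < 11 -> nth 0 (row_of i) j = f (e i) (e j).
Proof. by move=> j_lt; rewrite (nth_map ord0) ?size_vs. Qed.

Lemma count_row (P : pred 'I_11) : count P vs = #|P|.
Proof.
by rewrite (permP vs_enum) -sum1_card -sum1_count big_enum_cond.
Qed.

Lemma next_rowP (flags : seq bool) (m : nat) (k : seq nat -> bool) :
  m < 11 ->
  (forall j, 0 < j < 11 -> nth false flags j ->
     nth 0 (row_of m) j.-1 <= nth 0 (row_of m) j) ->
  nth false flags 0 = false ->
  next_row flags (map row_of (iota 0 m)) k -> k (row_of m).
Proof.
move=> m_lt sorted_m flag0; case: f_good => f_diag f_sym f_count f_odd.
rewrite /next_row size_map size_iota.
set cols := map _ (iota 0 11) => search.
apply: (search_rowP _ _ _ _ search) => //.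
- have cols_nth j : j < 11 -> nth (false, [::]) cols j = (nth false flags j,
      if j < m then [:: nth 0 (nth [::] (map row_of (iota 0 m)) j) m]
      else if j == m then [:: 0] else iota 0 7).
    by move=> j_lt; rewrite [LHS](nth_map 0) ?size_iota // nth_iota.
  apply: admissible_nth; rewrite !size_map ?size_vs // => j j_lt; rewrite cols_nth //=.
    rewrite nth_row_of //; case: ltnP => [j_m|m_j].
      by rewrite (nth_map 0) ?size_iota // nth_iota // nth_row_of // f_sym mem_head.
    have [->|_] := eqVneq j m; first by rewrite f_diag.
    by rewrite -[X in _ \in X]/(iota 0 7) mem_iota ltn_ord.
  by case: j j_lt => [|j] j_lt flag_j; [rewrite flag0 in flag_j|exact: (sorted_m j.+1)].
- by apply/allP => w /mapP[v _ ->]; exact: ltn_ord.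
- move=> rc /mapP[r /mapP[i]]; rewrite mem_iota /= add0n => i_lt -> ->.
  split; rewrite /= ?size_map // => d.
  rewrite -map_comp zip_map -map_comp count_map count_row nth_row_of //.
  have diffE l : nth 0 (nth [::] sub7_table (f (e i) l)) (f (e m) l) =
      (f (e i) l - f (e m) l)%R by rewrite -sub7E.
  have [d_lt|d_ge] := ltnP d 7; last first.
    rewrite eq_card0 // => l; rewrite !inE /= diffE.
    by apply/negbTE; rewrite neq_ltn (leq_trans (ltn_ord _) d_ge).
  rewrite (nth_map 0) ?size_iota // nth_iota // add0n.
  rewrite -[sub7 0 _]/(sub7 (0%R : 'I_7) _) sub7E sub0r.
  pose x : 'I_7 := Ordinal d_lt.
  have valE (y : 'I_7) : (d == y :> nat) = (x == y) by [].
  rewrite !valE -f_count; last first.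
    rewrite (nth_uniq ord0) ?size_vs ?(ltn_trans i_lt) ?(ltn_eqF i_lt) //.
    by rewrite (perm_uniq vs_enum) enum_uniq.
  apply/eq_leq/eq_card => l; rewrite !inE /= diffE.
  by rewrite eq_sym valE eq_sym.
- move=> x; rewrite count_map count_row.
  have [x_lt|x_ge] := ltnP x 7; last first.
    rewrite eq_card0; last first.
      move=> l; rewrite !inE /=; apply/negbTE.
      by rewrite neq_ltn (leq_trans (ltn_ord _) x_ge).
    by rewrite nth_default.
  transitivity (x == 0); last by case: x x_lt => [|[|[|[|[|[|[|]]]]]]].
  rewrite -[x == 0]/(Ordinal x_lt == 0%R) -(f_odd (e m)); congr (odd _).
Qed.
End SearchSound.

(** * Normalisation of the first two rows and nonexistence *)

Lemma mulrn_mod7 (x : 'I_7) (n : nat) : x *+ (n %% 7) = x *+ n.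
Proof.
by rewrite [in RHS](divn_eq n 7) mulrnDr mulnC mulrnA mulr7_eq0 mul0rn add0r.
Qed.

Lemma symmetric_exponents_scale (f : 'I_11 -> 'I_11 -> 'I_7) (a : nat) :
  (0 < a < 7)%N -> symmetric_exponents f ->
  symmetric_exponents (fun i j => f i j *+ a).
Proof.
move=> a_lt [f_diag f_sym f_count f_odd].
have [b ab] : exists b, ((a * b) %% 7 = 1)%N.
  move: a_lt; case: a => [|[|[|[|[|[|[|a]]]]]]] // _;
  by [exists 1%N|exists 4%N|exists 5%N|exists 2%N|exists 3%N|exists 6%N].
have aK (x : 'I_7) : x *+ a *+ b = x by rewrite -mulrnA -mulrn_mod7 ab.
have bK (x : 'I_7) : x *+ b *+ a = x by rewrite -mulrnA mulnC -mulrn_mod7 ab.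
have eqa (x y : 'I_7) : (x *+ a == y) = (x == y *+ b).
  by apply/eqP/eqP => [<-|->]; rewrite ?aK ?bK.
split=> [i|i j|i j ij x|i x].
- by rewrite f_diag mul0rn.
- by rewrite f_sym.
- rewrite !(eq_sym x) -mulNrn !eqa !(eq_sym _ (x *+ b)) -f_count //.
  by apply: eq_card => k; rewrite !inE -mulrnBl eqa.
- rewrite -[x == 0](eq_sym 0) -(mul0rn _ a) eqa eq_sym -(f_odd i); congr (odd _).
  by apply: eq_card => k; rewrite !inE eqa.
Qed.

Section NoSymmetricExponents.
Local Open Scope nat_scope.

(** The actual rows of [f] survive every search, so the recursion reaches fuel 0. *)
Lemma refuteP (f : 'I_11 -> 'I_11 -> 'I_7) (vs : seq 'I_11) (fuel m : nat) :
  symmetric_exponents f -> perm_eq vs (enum 'I_11) -> m + fuel <= 11 ->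
  ~ refute fuel (map (row_of f vs) (iota 0 m)).
Proof.
move=> f_good vs_enum; elim: fuel m => [|fuel IHfuel] m //= m_le.
move=> /(next_rowP f_good vs_enum) ref.
have {ref} : refute fuel (map (row_of f vs) (iota 0 m.+1)).
  rewrite -addn1 iotaD map_cat cats1; apply: ref => // [|j _].
    by lia.
  by rewrite nth_nil.
by apply: IHfuel; rewrite addSnnS.
Qed.

Lemma no_symmetric_exponents (f : 'I_11 -> 'I_11 -> 'I_7) : ~ symmetric_exponents f.
Proof.
move=> f_good; pose v0 : 'I_11 := ord0.
pose others := rem v0 (enum 'I_11).
pose ks0 := sort (fun k l => f v0 k <= f v0 l) others.
have enum_v0 (ks : seq 'I_11) : perm_eq ks others -> perm_eq (v0 :: ks) (enum 'I_11).
  move=> ks_others; apply: (@perm_trans _ (v0 :: others)); first by rewrite perm_cons.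
  by rewrite perm_sym perm_to_rem // mem_enum.
have ks0_perm : perm_eq ks0 others by rewrite perm_sort.
have vs0_enum := enum_v0 _ ks0_perm.
have ks0_size : size ks0 = 10 by have := perm_size vs0_enum; rewrite size_enum_ord => -[].
have ks0_sorted : sorted leq [seq nat_of_ord (f v0 k) | k <- ks0].
  by rewrite sorted_map sort_sorted // => k l; exact: leq_total.
have : covered (row_of f (v0 :: ks0) 0).
  apply: (@next_rowP _ _ f_good vs0_enum [seq 1 < j | j <- iota 0 11] 0 covered
    isT _ erefl covered_all) => j /andP[_ j_lt].
  rewrite (nth_map 0) ?size_iota // nth_iota //; case: j j_lt => [|[|j]] //= j_lt _.
  by move/(sortedP 0): ks0_sorted; apply; rewrite size_map ks0_size.
move=> /hasP[a]; rewrite mem_iota => a_lt /hasP[[c h] ch /andP[/= c_h /eqP h_sort]].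
pose g i j := (f i j *+ a)%R.
have g_good : symmetric_exponents g.
  by apply: symmetric_exponents_scale.
have g_h : perm_eq [seq nat_of_ord (g v0 k) | k <- others] (double_letters h).
  rewrite h_sort perm_sym perm_sort /= -map_comp.
  rewrite (eq_map (g := fun k => nat_of_ord (g v0 k))) ?perm_map //.
  by move=> k; rewrite /= /g Zp_mulrn.
(* The second index is chosen so that its entry in row [v0] is the prescribed [c]. *)
have /mapP[v1 v1_others c_v1] : c \in [seq nat_of_ord (g v0 k) | k <- others].
  rewrite (perm_mem g_h); apply/flatten_mapP; exists c => //; exact: mem_head.
(* Letters are below 7, so [key] sorts by row [v0] and breaks ties by row [v1], as the flags of
   [refute_row] require. *)
pose key k := 7 * g v0 k + g v1 k.
pose ks := sort (fun k l => key k <= key l) (rem v1 others).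
have ks_perm : perm_eq ks (rem v1 others) by rewrite perm_sort.
have vs_enum : perm_eq [:: v0, v1 & ks] (enum 'I_11).
  apply: enum_v0; apply: (@perm_trans _ (v1 :: rem v1 others)).
    by rewrite perm_cons.
  by rewrite perm_sym perm_to_rem.
have key_sorted : sorted leq (map key ks).
  by rewrite sorted_map sort_sorted // => k l; exact: leq_total.
have ks_row : [seq nat_of_ord (g v0 k) | k <- ks] = rem c (double_letters h).
  apply: (@sorted_eq _ leq leq_trans anti_leq).
  - rewrite sorted_map; move: key_sorted; rewrite sorted_map.
    have keyE k : key k %/ 7 = g v0 k.
      by rewrite /key mulnC divnMDl // divn_small ?addn0 // ltn_ord.
    by apply: sub_sorted => k l /= kl; rewrite -!keyE leq_div2r.
  - rewrite (subseq_sorted leq_trans (rem_subseq _ _)) // h_sort.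
    by rewrite sort_sorted //; exact: leq_total.
  - have ks_others : perm_eq (v1 :: ks) others.
      apply: (@perm_trans _ (v1 :: rem v1 others)); first by rewrite perm_cons.
      by rewrite perm_sym perm_to_rem.
    suff: perm_eq [seq nat_of_ord (g v0 k) | k <- v1 :: ks]
        (c :: rem c (double_letters h)).
      by rewrite /= -c_v1 perm_cons.
    apply: perm_trans (perm_map _ ks_others) (perm_trans g_h _).
    by apply: perm_to_rem; rewrite -(perm_mem g_h); apply/mapP; exists v1.
have [g_diag _ _ _] := g_good.
have row0 : row_of g [:: v0, v1 & ks] 0 = first_row (c, h).
  by rewrite /row_of /= ks_row /first_row /= g_diag c_v1.
have := allP refute_all _ ch; rewrite -row0 => ref.
pose row := row_of g [:: v0, v1 & ks].
apply: (@refuteP g [:: v0, v1 & ks] 3 2 g_good vs_enum isT).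
apply: (@next_rowP _ _ g_good vs_enum
  [seq (2 < j) && (nth 0 (row 0) j.-1 == nth 0 (row 0) j) | j <- iota 0 11] 1
  (fun row1 => refute 3 [:: row 0; row1]) isT _ erefl ref) => j /andP[_ j_lt].
rewrite (nth_map 0) ?size_iota // nth_iota //; case: j j_lt => [|[|[|j]]] //= j_lt.
have ks_size : size ks = 9 by have := perm_size vs_enum; rewrite size_enum_ord => -[].
have j_ks : j.+1 < size ks by rewrite ks_size.
have j_ks' := ltnW j_ks; rewrite !(nth_map v0) // => /eqP g_eq.
move/(sortedP 0)/(_ j): key_sorted; rewrite size_map j_ks => /(_ isT).
by rewrite !(nth_map v0) // /key g_eq leq_add2l.
Qed.
End NoSymmetricExponents.

(* Combination of the four cases *)
From mathcomp Require Import classical_sets reals.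
From mathcomp Require Import complex.

Lemma BH_orthogonal (C : numClosedFieldType) (n q : nat) (H : 'M[C]_n) :
  BH C n q H -> forall i j, i != j -> \sum_k H i k * (H j k)^* = 0.
Proof.
move=> [_ /matrixP H_unitary] i j ij; have := H_unitary i j.
rewrite !mxE (negbTE ij) mulr0n => ij0; rewrite -[RHS]ij0.
by apply: eq_bigr => k _; rewrite !mxE.
Qed.

Local Open Scope complex_scope.
Local Open Scope classical_set_scope.

Theorem mainTheorem8 (R : realType) (q : nat) (hq : q \in [:: 10; 12; 14; 15]%N) :
  BH R[i] 11 q = set0.
Proof.
rewrite -subset0 => H H_BH.
have H_orth := BH_orthogonal H_BH.
have [H_root H_unitary] := H_BH.
move: hq; rewrite !inE => /or4P[] /eqP qE; rewrite {}qE in H_BH H_root.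
- have [s [a count]] := double_prime_exponents (isT : prime 5) isT H_root H_orth.
  apply: (@sign_dot_not_pm5 s) => i j ij.
  by have [t /sign_dot_count ->] := count i j ij; exists t.
- exact: no_BH_11_12 H_root H_unitary.
- have [s [a count]] := double_prime_exponents (isT : prime 7) isT H_root H_orth.
  by have [f /no_symmetric_exponents] := symmetric_exponents_exist count.
- have [z z_prim] := exists_prim_root R[i] (isT : (0 < 15)%N).
  have [a count] := fifteen_counts z_prim H_root H_orth.
  (* Shifting each row by its own sum moves the difference of multiplicity 7 to 0. *)
  pose b i k := a i k + \sum_l a i l.
  apply: (@ternary_matrix_contradiction _ _ b (cube_prim z_prim)) => i j ij x.
  have [t /ternary_counts counts] := count i j ij.
  rewrite (eq_card (B := [pred k | a i k - a j k ==
      x + (\sum_l a j l - \sum_l a i l)])) ?counts.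
    by rewrite -[X in _ == X]add0r (inj_eq (addIr _)).
  by move=> k; rewrite !inE /b sub_add_eq opprB.
Qed.
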